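(* For all positive integers $q$ and $n$, the following four infinite product identities hold: \[ \prod_{k = 1}^\infty \frac{F_{4nq + 4nk} + ( - 1)^{k - 1} F_{4nq} }{F_{4nq + 4nk} + ( - 1)^k F_{4nq} } = \prod_{k = 1}^q \frac{L_{2n(2k - 1)} F_{4nk} }{F_{2n(2k - 1)} L_{4nk} }, \] \[ \prod_{k = 1}^\infty \frac{F_{(2n - 1)(2q + 2k)} + ( - 1)^{k - 1} F_{(2n - 1)2q} }{F_{(2n - 1)(2q + 2k)} + ( - 1)^k F_{(2n - 1)2q} } = 5^q \prod_{k = 1}^q \frac{F_{(2n - 1)(2k - 1)} F_{(2n - 1)2k} }{L_{(2n - 1)(2k - 1)} L_{(2n - 1)2k} }, \] \[ \prod_{k = 1}^\infty \frac{L_{4nk + 4nq - 2n} + ( - 1)^{k - 1} L_{4nq - 2n} }{L_{4nk + 4nq - 2n} + ( - 1)^k L_{4nq - 2n} } = \frac{1}{\sqrt 5 }\prod_{k = 1}^q \frac{L_{2n(2k - 1)} }{F_{2n(2k - 1)} } \prod_{k = 1}^{q - 1} \frac{F_{4nk} }{L_{4nk} }, \] \[ \prod_{k = 1}^\infty \frac{F_{(2n - 1)(2q + 2k - 1)} + ( - 1)^{k - 1} F_{(2n - 1)(2q - 1)} }{F_{(2n - 1)(2q + 2k - 1)} + ( - 1)^k F_{(2n - 1)(2q - 1)} } = (\sqrt 5 )^{2q - 1} \prod_{k = 1}^q \frac{F_{(2n - 1)(2k - 1)} }{L_{(2n - 1)(2k - 1)} } \prod_{k = 1}^{q - 1} \frac{F_{(2n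 - 1)2k} }{L_{(2n - 1)2k} }. \]
   Context: The Fibonacci numbers $F_j$ and Lucas numbers $L_j$ are defined for integers $j\ge 0$ by $F_0=0$, $F_1=1$, $F_j=F_{j-1}+F_{j-2}$ and $L_0=2$, $L_1=1$, $L_j=L_{j-1}+L_{j-2}$. An empty product $\prod_{k=1}^0$ equals $1$. *)

(* Defs.v *)
From mathcomp Require Export all_boot all_order all_algebra.
From mathcomp Require Export all_classical all_reals all_analysis.
Export Order.TTheory GRing.Theory Num.Theory numFieldNormedType.Exports.

Set Implicit Arguments.
Unset Strict Implicit.
Unset Printing Implicit Defensive.

Local Open Scope classical_set_scope.
Local Open Scope ring_scope.

Fixpoint fib (n : nat) : nat :=
  match n with
  | 0 => 0
  | 1 => 1
  | (m.+1 as p).+1 => fib p + fib m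
  end%N.

Fixpoint lucas (n : nat) : nat :=
  match n with
  | 0 => 2
  | 1 => 1
  | (m.+1 as p).+1 => lucas p + lucas m
  end%N.

(* \prod_{k = 1}^{oo} u k = l, as the limit of the partial products;
   indices start at 1 and u 0 is ignored. *)
Definition infprod_eq (R : realType) (u : nat -> R) (l : R) : Prop :=
  (fun N : nat => \prod_(1 <= k < N.+1) u k) @ \oo --> l.

(* Main.v *)
(* Put x = phi^m and w = (-1)^(m+1) psi^m, where phi, psi = (1 +- sqrt 5)/2, so
   that x w = -1.  According to the parities of m and j, x^j - w^j is
   sqrt 5 F_(mj) or L_(mj); in each of the four identities the numbers in the
   product are multiples of G j = x^j - w^j.  Writing (-1)^k = x^k w^k,
     G (p+2k) - (-1)^k G p = (x^(p+k) + w^(p+k)) (x^k - w^k),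
     G (p+2k) + (-1)^k G p = (x^(p+k) - w^(p+k)) (x^k + w^k),
   so the k-th factor is u (p+k) / u k with u k = (x^k + w^k) / (x^k - w^k).
   Since u tends to 1, the infinite product telescopes to 1 / (u 1 ... u p). *)

Require Import Defs.
From mathcomp Require Import ring lra zify.

Set Implicit Arguments.
Unset Strict Implicit.
Unset Printing Implicit Defensive.

Local Open Scope ring_scope.

(** * Convergence of telescoping infinite products *)

Section Products.
Local Open Scope classical_set_scope.
Variable R : realType.
Implicit Types (u v : nat -> R) (x w : R).

Lemma eq_infprod u v l : (forall k, (0 < k)%N -> u k = v k) ->
  infprod_eq u l -> infprod_eq v l.
Proof.
move=> uv; rewrite /infprod_eq.
suff -> : (fun N => \prod_(1 <= k < N.+1) u k) =
          (fun N => \prod_(1 <= k < N.+1) v k) by [].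
by apply/funext => N; apply: eq_big_nat => k /andP[k0 _]; exact: uv.
Qed.

(** Induction on [p]: passing from [p] to [p.+1] multiplies the [N]-th partial product by
    [u (N + p.+1) / u p.+1], which tends to [(u p.+1)^-1] because [u] tends to 1. *)
Lemma infprod_shift_ratio u (p : nat) : (forall k, (0 < k)%N -> u k != 0) ->
  u @ \oo --> (1 : R) ->
  infprod_eq (fun k => u (p + k)%N / u k) (\prod_(1 <= k < p.+1) (u k)^-1).
Proof.
move=> u0 u1; elim: p => [|p IH].
  rewrite big_geq // /infprod_eq.
  suff -> : (fun N => \prod_(1 <= k < N.+1) (u (0 + k)%N / u k)) = cst 1
    by exact: cvg_cst.
  apply/funext => N; rewrite big_nat big1 // => k /andP[k0 _].
  by rewrite add0n divff// u0.
rewrite big_nat_recr //= /infprod_eq.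
have -> : (fun N => \prod_(1 <= k < N.+1) (u (p.+1 + k)%N / u k)) =
    (fun N => \prod_(1 <= k < N.+1) (u (p + k)%N / u k)) \*
    (fun N => u (N + p.+1)%N / u p.+1).
  (* The empty product is treated apart because telescoping needs a nonempty range. *)
  apply/funext => -[|N] /=.
    by rewrite !big_geq // mul1r divff // u0.
  (* Each new factor is the old one times [u (p + k.+1) / u (p + k)], and the product of these
     corrections telescopes. *)
  rewrite (eq_big_nat _ _ (F2 := fun k => (u (p + k)%N / u k) *
     (u (p + k.+1)%N / u (p + k)%N))); last first.
    move=> k /andP[k0 _]; rewrite addnS addSn.
    have := u0 _ k0; have : u (p + k)%N != 0 by apply: u0; lia.
    by move=> ? ?; field; apply/andP.
  rewrite big_split /= (telescope_prodf (f := fun k => u (p + k)%N)) //.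
    by rewrite addn1 -addSnnS addnC.
  by move=> k /andP[k1 _]; apply: u0; lia.
apply: (cvgM IH); rewrite -[X in _ --> X]mul1r.
apply: (@cvgM _ _ _ _ (fun N => u (N + p.+1)%N) (cst (u p.+1)^-1)).
  by rewrite (cvg_shiftn p.+1 u).
exact: cvg_cst.
Qed.

(** The constant [c] absorbs the factor sqrt 5 of Binet's formula: [c * A k] is [G (p + 2 * k)], and
    [c] cancels in every quotient. Since [|w ^+ k| <= 1 < x ^+ k] for [k > 0], neither
    [x ^+ k + w ^+ k] nor [x ^+ k - w ^+ k] vanishes there. *)
Lemma telescoping_infprod (A : nat -> R) x w c (p : nat) :
  1 < x -> x * w = -1 -> c != 0 ->
  (forall k, c * A k = x ^+ (p + 2 * k) - w ^+ (p + 2 * k)) ->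
  infprod_eq (fun k => (A k + (-1) ^+ (k - 1) * A 0%N) /
                       (A k + (-1) ^+ k * A 0%N))
    (\prod_(1 <= k < p.+1) ((x ^+ k - w ^+ k) / (x ^+ k + w ^+ k))).
Proof.
move=> x1 xw c0 AE.
have x0 : x != 0 by apply/eqP => xE; rewrite xE in x1; lra.
have wE : w = - x^-1 by apply: (mulfI x0); rewrite xw mulrN divff.
have nw : `|w| < 1 by rewrite wE normrN gtr0_norm ?invf_lt1 ?invr_gt0; lra.
have wk k : `|w ^+ k| <= 1 by rewrite normrX exprn_ile1// ltW.
have xk k : (0 < k)%N -> 1 < x ^+ k by move=> k0; rewrite exprn_egt1 //; lia.
have Dn k : (0 < k)%N -> x ^+ k - w ^+ k != 0.
  move=> k0; have := xk _ k0; have := wk k; rewrite ler_norml => /andP[a b] d.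
  by rewrite gt_eqF //; lra.
have Sn k : (0 < k)%N -> x ^+ k + w ^+ k != 0.
  move=> k0; have := xk _ k0; have := wk k; rewrite ler_norml => /andP[a b] d.
  by rewrite gt_eqF //; lra.
pose u k := (x ^+ k + w ^+ k) / (x ^+ k - w ^+ k).
have -> : \prod_(1 <= k < p.+1) ((x ^+ k - w ^+ k) / (x ^+ k + w ^+ k)) =
          \prod_(1 <= k < p.+1) (u k)^-1.
  by apply: eq_bigr => k _; rewrite /u invf_div.
apply: (@eq_infprod (fun k => u (p + k)%N / u k)); last first.
  apply: infprod_shift_ratio => [k k0|].
    by rewrite /u mulf_neq0 ?invr_eq0 ?Dn ?Sn.
  (* Dividing through by [x ^+ k] turns [u k] into [(1 + r ^+ k) / (1 - r ^+ k)], with [r ^+ k]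
     tending to 0. At [k = 0] both forms are 0, as the inverse of 0 is 0. *)
  pose r := w / x.
  have r1 : `|r| < 1.
    rewrite /r normrM (le_lt_trans _ nw) // ler_piMr //.
    by rewrite gtr0_norm ?invr_gt0 ?invf_le1; lra.
  have -> : u = (fun k => (1 + r ^+ k) * (1 - r ^+ k)^-1).
    apply/funext => k; rewrite /u /r expr_div_n.
    have xk0 : x ^+ k != 0 by rewrite expf_neq0.
    have -> : 1 + w ^+ k / x ^+ k = (x ^+ k + w ^+ k) / x ^+ k by field.
    have -> : 1 - w ^+ k / x ^+ k = (x ^+ k - w ^+ k) / x ^+ k by field.
    by rewrite invf_div mulrA divfK.
  have cr : (fun k => r ^+ k) @ \oo --> (0 : R) by exact: cvg_expr.
  rewrite [X in _ --> X](_ : _ = (1 + 0) * (1 - 0)^-1); last first.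
    by rewrite addr0 subr0 invr1 mulr1.
  apply: cvgM.
    by apply: cvgD cr; exact: cvg_cst.
  apply: cvgV; first by rewrite subr0 oner_eq0.
  by apply: cvgB cr; exact: cvg_cst.
move=> k k0 /=.
have sk : (-1) ^+ k = x ^+ k * w ^+ k :> R by rewrite -exprMn xw.
(* Here [0 < k] matters, since the natural subtraction [k - 1] truncates at 0. *)
have sk1 : (-1) ^+ (k - 1) = - (x ^+ k * w ^+ k) :> R.
  by rewrite -sk -{2}(subnK k0) exprD expr1 mulrN1 opprK.
have A0 := AE 0%N; rewrite muln0 addn0 in A0.
have num : c * (A k + (-1) ^+ (k - 1) * A 0%N) =
    (x ^+ (p + k) + w ^+ (p + k)) * (x ^+ k - w ^+ k).
  by rewrite mulrDr mulrCA AE A0 sk1 mul2n -addnn !exprD; ring.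
have den : c * (A k + (-1) ^+ k * A 0%N) =
    (x ^+ (p + k) - w ^+ (p + k)) * (x ^+ k + w ^+ k).
  by rewrite mulrDr mulrCA AE A0 sk mul2n -addnn !exprD; ring.
(* Expand the fraction by [c], so that both factorisations apply. *)
rewrite -[RHS]mul1r -[X in _ = X * _](divff c0) mulf_div num den /u.
by rewrite invf_div mulf_div.
Qed.

End Products.

(** * Splitting finite products by the parity of the index *)

Lemma prod_odd_even (R : comPzRingType) (v : nat -> R) (q : nat) :
  \prod_(1 <= k < (2 * q).+1) v k =
  \prod_(1 <= k < q.+1) (v (2 * k - 1)%N * v (2 * k)%N).
Proof.
elim: q => [|q IH]; first by rewrite !big_geq.
rewrite [RHS]big_nat_recr //= -IH mulnS add2n big_nat_recr //= big_nat_recr //=.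
by rewrite subSS subn0 mulrA.
Qed.

Lemma prod_odd_even_pred (R : comPzRingType) (v : nat -> R) (q : nat) :
  (0 < q)%N ->
  \prod_(1 <= k < (2 * q - 1).+1) v k =
  \prod_(1 <= k < q.+1) v (2 * k - 1)%N * \prod_(1 <= k < q) v (2 * k)%N.
Proof.
case: q => // q _; rewrite mulnS add2n subSS subn0 big_nat_recr //=.
rewrite prod_odd_even big_split /= [in RHS]big_nat_recr //=.
by rewrite mulnS add2n subSS subn0 mulrAC.
Qed.

(** * Binet's formulas and the two choices of [w] *)

Section Binet.
Variable R : realType.

Let s5 : R := Num.sqrt 5.
Definition golden : R := (1 + s5) / 2.
Definition golden_conj : R := (1 - s5) / 2.

Let s5E : s5 * s5 = 5.
Proof. by rewrite -expr2 sqr_sqrtr. Qed.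

Lemma sqrt5_gt1 : 1 < s5.
Proof.
have : 0 <= s5 by exact: sqrtr_ge0.
by have := s5E; nra.
Qed.

Lemma golden_gt1 : 1 < golden.
Proof. by have := sqrt5_gt1; rewrite /golden; lra. Qed.

Lemma golden_mul_conj : golden * golden_conj = -1.
Proof. by have := s5E; rewrite /golden /golden_conj; lra. Qed.

Lemma goldenX_rec k : golden ^+ k.+2 = golden ^+ k.+1 + golden ^+ k.
Proof.
have e : golden * golden = golden + 1 by have := s5E; rewrite /golden; lra.
by rewrite !exprS mulrA e; ring.
Qed.

Lemma golden_conjX_rec k :
  golden_conj ^+ k.+2 = golden_conj ^+ k.+1 + golden_conj ^+ k.
Proof.
have e : golden_conj * golden_conj = golden_conj + 1.
  by have := s5E; rewrite /golden_conj; lra.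
by rewrite !exprS mulrA e; ring.
Qed.

Lemma binet_fib j : s5 * (fib j)%:R = golden ^+ j - golden_conj ^+ j.
Proof.
suff: s5 * (fib j)%:R = golden ^+ j - golden_conj ^+ j /\
      s5 * (fib j.+1)%:R = golden ^+ j.+1 - golden_conj ^+ j.+1 by case.
elim: j => [|j [IH1 IH2]].
  by split; rewrite ?expr0 ?expr1 /= /golden /golden_conj; lra.
split=> //; rewrite goldenX_rec golden_conjX_rec.
rewrite [fib j.+2](_ : _ = (fib j.+1 + fib j)%N) // natrD mulrDr IH1 IH2; ring.
Qed.

Lemma binet_lucas j : (lucas j)%:R = golden ^+ j + golden_conj ^+ j.
Proof.
suff: (lucas j)%:R = golden ^+ j + golden_conj ^+ j /\
      (lucas j.+1)%:R = golden ^+ j.+1 + golden_conj ^+ j.+1 by case.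
elim: j => [|j [IH1 IH2]].
  by split; rewrite ?expr0 ?expr1 /= /golden /golden_conj; lra.
split=> //; rewrite goldenX_rec golden_conjX_rec.
rewrite [lucas j.+2](_ : _ = (lucas j.+1 + lucas j)%N) // natrD IH1 IH2; ring.
Qed.

(** For odd [m] the powers [golden ^+ m] and [golden_conj ^+ m] already have product -1, so they
    serve as [x] and [w], and [G j] is sqrt 5 times a Fibonacci number for every [j]. *)
Lemma infprod_fib_odd (m p : nat) : odd m ->
  infprod_eq (fun k => ((fib (m * (p + 2 * k)))%:R +
                          (-1) ^+ (k - 1) * (fib (m * p))%:R) /
                       ((fib (m * (p + 2 * k)))%:R +
                          (-1) ^+ k * (fib (m * p))%:R))
    (\prod_(1 <= k < p.+1)
       (s5 * ((fib (m * k))%:R / (lucas (m * k))%:R))).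
Proof.
move=> om; have m0 : (0 < m)%N by case: m om.
have := @telescoping_infprod R (fun k => (fib (m * (p + 2 * k)))%:R)
  (golden ^+ m) (golden_conj ^+ m) s5 p.
have -> : \prod_(1 <= k < p.+1) (((golden ^+ m) ^+ k - (golden_conj ^+ m) ^+ k)
            / ((golden ^+ m) ^+ k + (golden_conj ^+ m) ^+ k)) =
          \prod_(1 <= k < p.+1) (s5 * ((fib (m * k))%:R / (lucas (m * k))%:R)).
  by apply: eq_bigr => k _; rewrite mulrA binet_fib binet_lucas !exprM.
rewrite muln0 addn0; apply.
- by rewrite exprn_egt1 ?golden_gt1 //; lia.
- by rewrite -exprMn golden_mul_conj -signr_odd om.
- by rewrite gt_eqF // (lt_trans _ sqrt5_gt1).
- by move=> k; rewrite binet_fib !exprM.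
Qed.

(** For even [m] this is [(x ^+ k - w ^+ k) / (x ^+ k + w ^+ k)] with [w = - golden_conj ^+ m]: the
    sign of [w ^+ k] exchanges sum and difference when [k] is odd. *)
Definition alt_ratio (m k : nat) : R :=
  if odd k then (lucas (m * k))%:R / (s5 * (fib (m * k))%:R)
  else s5 * (fib (m * k))%:R / (lucas (m * k))%:R.

(** For even [m] the conjugate power must be negated to get [x * w = -1]. As [p + 2 * k] has the
    parity of [p], the sequence [G (p + 2 * k)] consists either of Lucas numbers only or of
    multiples of Fibonacci numbers only. *)
Lemma infprod_even (A : nat -> R) (m p : nat) (c : R) : (0 < m)%N -> ~~ odd m ->
  c != 0 ->
  (forall k, c * A k = if odd p then (lucas (m * (p + 2 * k)))%:R
                       else s5 * (fib (m * (p + 2 * k)))%:R) ->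
  infprod_eq (fun k => (A k + (-1) ^+ (k - 1) * A 0%N) /
                       (A k + (-1) ^+ k * A 0%N))
    (\prod_(1 <= k < p.+1) alt_ratio m k).
Proof.
move=> m0 em c0 AE.
have wj j : (- golden_conj ^+ m) ^+ j = (-1) ^+ odd j * golden_conj ^+ (m * j).
  by rewrite [LHS]exprNn signr_odd exprM.
have := @telescoping_infprod R A (golden ^+ m) (- golden_conj ^+ m) c p.
have -> : \prod_(1 <= k < p.+1)
            (((golden ^+ m) ^+ k - (- golden_conj ^+ m) ^+ k)
            / ((golden ^+ m) ^+ k + (- golden_conj ^+ m) ^+ k)) =
          \prod_(1 <= k < p.+1) alt_ratio m k.
  apply: eq_bigr => k _; rewrite /alt_ratio binet_fib binet_lucas wj -exprM.
  by case: (odd k); rewrite ?mulN1r ?mul1r ?opprK.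
apply=> //.
- by rewrite exprn_egt1 ?golden_gt1 //; lia.
- by rewrite mulrN -exprMn golden_mul_conj -signr_odd (negbTE em).
- move=> k; rewrite AE wj binet_fib binet_lucas -exprM oddD mul2n odd_double addbF.
  by case: (odd p); rewrite ?mulN1r ?mul1r ?opprK.
Qed.

End Binet.

(** * The four identities, from [m] equal to 2n or 2n - 1 and [p] equal to 2q or 2q - 1 *)

Theorem theorem3 (R : realType) (q n : nat) (hq : (0 < q)%N) (hn : (0 < n)%N) :
  let F (j : nat) : R := (fib j)%:R in
  let L (j : nat) : R := (lucas j)%:R in
  [/\ infprod_eq
        (fun k : nat =>
           (F (4 * n * q + 4 * n * k)%N + (-1) ^+ (k - 1) * F (4 * n * q)%N) /
           (F (4 * n * q + 4 * n * k)%N + (-1) ^+ k * F (4 * n * q)%N))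
        (\prod_(1 <= k < q.+1)
           ((L (2 * n * (2 * k - 1))%N * F (4 * n * k)%N) /
            (F (2 * n * (2 * k - 1))%N * L (4 * n * k)%N))),
      infprod_eq
        (fun k : nat =>
           (F ((2 * n - 1) * (2 * q + 2 * k))%N
              + (-1) ^+ (k - 1) * F ((2 * n - 1) * (2 * q))%N) /
           (F ((2 * n - 1) * (2 * q + 2 * k))%N
              + (-1) ^+ k * F ((2 * n - 1) * (2 * q))%N))
        (5 ^+ q *
         \prod_(1 <= k < q.+1)
           ((F ((2 * n - 1) * (2 * k - 1))%N * F ((2 * n - 1) * (2 * k))%N) /
            (L ((2 * n - 1) * (2 * k - 1))%N * L ((2 * n - 1) * (2 * k))%N))),
      infprod_eq
        (fun k : nat =>
           (L (4 * n * k + 4 * n * q - 2 * n)%N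
              + (-1) ^+ (k - 1) * L (4 * n * q - 2 * n)%N) /
           (L (4 * n * k + 4 * n * q - 2 * n)%N
              + (-1) ^+ k * L (4 * n * q - 2 * n)%N))
        (1 / Num.sqrt 5 *
         (\prod_(1 <= k < q.+1)
            (L (2 * n * (2 * k - 1))%N / F (2 * n * (2 * k - 1))%N)) *
         (\prod_(1 <= k < q) (F (4 * n * k)%N / L (4 * n * k)%N)))
    & infprod_eq
        (fun k : nat =>
           (F ((2 * n - 1) * (2 * q + 2 * k - 1))%N
              + (-1) ^+ (k - 1) * F ((2 * n - 1) * (2 * q - 1))%N) /
           (F ((2 * n - 1) * (2 * q + 2 * k - 1))%N
              + (-1) ^+ k * F ((2 * n - 1) * (2 * q - 1))%N))
        (Num.sqrt 5 ^+ (2 * q - 1) *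
         (\prod_(1 <= k < q.+1)
            (F ((2 * n - 1) * (2 * k - 1))%N / L ((2 * n - 1) * (2 * k - 1))%N)) *
         (\prod_(1 <= k < q)
            (F ((2 * n - 1) * (2 * k))%N / L ((2 * n - 1) * (2 * k))%N)))].
Proof.
move=> F L.
have s0 : Num.sqrt 5 != 0 :> R by rewrite gt_eqF // sqrtr_gt0.
have ss : Num.sqrt 5 * Num.sqrt 5 = 5 :> R by rewrite -expr2 sqr_sqrtr.
have om : odd (2 * n - 1) by lia.
have em : ~~ odd (2 * n) by lia.
have m0 : (0 < 2 * n)%N by lia.
have ar1 k : (0 < k)%N -> alt_ratio R (2 * n) (2 * k - 1) =
    (Num.sqrt 5)^-1 * (L (2 * n * (2 * k - 1))%N / F (2 * n * (2 * k - 1))%N).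
  move=> k0; rewrite /alt_ratio ifT; last by lia.
  by rewrite invfM mulrCA.
have ar2 k : alt_ratio R (2 * n) (2 * k) =
    Num.sqrt 5 * (F (4 * n * k)%N / L (4 * n * k)%N).
  rewrite /alt_ratio ifF; last by lia.
  by rewrite (_ : 2 * n * (2 * k) = 4 * n * k)%N ?mulrA //; lia.
split.
(* Here [m] is 2n and [p] is 2q; in each odd-even pair the factors sqrt 5 cancel. *)
- have := @infprod_even R (fun k => F (4 * n * q + 4 * n * k)%N) (2 * n) (2 * q)
    (Num.sqrt 5) m0 em s0.
  rewrite muln0 addn0 prod_odd_even.
  rewrite [X in (_ -> infprod_eq _ X) -> _](eq_big_nat _ _ (F2 := fun k =>
    (L (2 * n * (2 * k - 1))%N * F (4 * n * k)%N) /
    (F (2 * n * (2 * k - 1))%N * L (4 * n * k)%N))); last first.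
    move=> k /andP[k0 _]; rewrite ar1 // ar2 mulrACA mulVf // mul1r.
    by rewrite invfM mulrACA.
  apply=> k; rewrite ifF; last by lia.
  by rewrite (_ : 2 * n * _ = 4 * n * q + 4 * n * k)%N //; lia.
(* Each of the [q] pairs contributes sqrt 5 twice, whence [5 ^+ q]. *)
- have := @infprod_fib_odd R (2 * n - 1) (2 * q) om.
  rewrite prod_odd_even.
  rewrite [X in infprod_eq _ X -> _](eq_bigr (fun k => 5 *
     ((F ((2 * n - 1) * (2 * k - 1))%N * F ((2 * n - 1) * (2 * k))%N) /
      (L ((2 * n - 1) * (2 * k - 1))%N * L ((2 * n - 1) * (2 * k))%N))));
    last by move=> k _; rewrite mulrACA ss mulf_div.
  by rewrite big_split /= prodr_const_nat (subn1 q.+1).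
- have := @infprod_even R (fun k => L (4 * n * k + 4 * n * q - 2 * n)%N) (2 * n)
    (2 * q - 1) 1 m0 em (oner_neq0 R).
  rewrite muln0 add0n prod_odd_even_pred //.
  rewrite [X in (_ -> infprod_eq _ (X * _)) -> _](eq_big_nat _ _
    (F2 := fun k => (Num.sqrt 5)^-1 *
    (L (2 * n * (2 * k - 1))%N / F (2 * n * (2 * k - 1))%N))); last first.
    by move=> k /andP[k0 _]; exact: ar1.
  rewrite (eq_bigr _ (fun k _ => ar2 k)) !big_split /= !prodr_const_nat.
  (* The [q] odd indices give sqrt 5 in the denominator and the [q - 1] even ones in the numerator,
     so a single [1 / Num.sqrt 5] survives. *)
  have -> : (Num.sqrt 5)^-1 ^+ (q.+1 - 1) = 1 / Num.sqrt 5 / Num.sqrt 5 ^+ (q - 1) :> R.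
    by rewrite subn1 /= -{1}(subnK hq) addn1 exprS div1r exprVn.
  rewrite mulrACA divfK ?expf_neq0 // mulrA.
  apply=> k; rewrite ifT; last by lia.
  by rewrite mul1r /L; congr ((lucas _)%:R); nia.
(* All [2 * q - 1] factors carry sqrt 5; it is pulled out before the split by parity. *)
- have := @infprod_fib_odd R (2 * n - 1) (2 * q - 1) om.
  rewrite big_split /= prodr_const_nat (subn1 _.+1) /= prod_odd_even_pred // mulrA.
  apply: eq_infprod => k k0.
  by rewrite (_ : 2 * q - 1 + 2 * k = 2 * q + 2 * k - 1)%N //; lia.
Qed.
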